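(* The solutions $(H,u,w,p)$ of the two-dimensional incompressible free-surface Euler system with its boundary conditions (written out in the context) which satisfy the closure relations $$\langle\varphi u^2\rangle=\frac{\langle\varphi u\rangle^2}{\langle\varphi\rangle},\qquad \langle\varphi uw\rangle=\frac{\langle\varphi u\rangle\langle\varphi w\rangle}{\langle\varphi\rangle},\qquad \langle\varphi zu\rangle=\langle\varphi z\rangle\frac{\langle\varphi u\rangle}{\langle\varphi\rangle},\qquad p_{nh}|_b=2\,\frac{\langle\varphi p_{nh}\rangle}{\langle\varphi\rangle}$$ are also solutions of the system $$\frac{\partial}{\partial t}\langle\varphi\rangle+\frac{\partial}{\partial x}\langle\varphi u\rangle=0,$$ $$\frac{\partial}{\partial t}\langle\varphi u\rangle+\frac{\partial}{\partial x}\left(\frac{\langle\varphi u\rangle^2}{\langle\varphi\rangle}+g\langle\varphi(\eta-z)\rangle+\langle\varphi p_{nh}\rangle\right)=-\left(g\langle\varphi\rangle+2\frac{\langle\varphi p_{nh}\rangle}{\langle\varphi\rangle}\right)\frac{\partial z_b}{\partial x},$$ $$\frac{\partial}{\partial t}\langle\varphi w\rangle+\frac{\partial}{\partial x}\left(\langle\varphi w\rangle\frac{\langle\varphi u\rangle}{\langle\varphi\rangle}\right)=2\frac{\langle\varphi p_{nh}\rangle}{\langle\varphi\rangle},$$ $$\frac{\partial}{\partial t}\langle\varphi z\rangle+\frac{\partial}{\partial x}\left(\langle\varphi z\rangle\frac{\langle\varphi u\rangle}{\langle\varphi\rangle}\right)=\langle\varphi w\rangle.$$ This system is a depth-averaged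 approximation of the Euler system and admits, for smooth solutions, an energy balance of the form $$\frac{\partial}{\partial t}\left\langle\varphi E\left(z;\tfrac{\langle\varphi u\rangle}{\langle\varphi\rangle},\tfrac{\langle\varphi w\rangle}{\langle\varphi\rangle}\right)\right\rangle+\frac{\partial}{\partial x}\left[\frac{\langle\varphi u\rangle}{\langle\varphi\rangle}\left(\left\langle\varphi E\left(z;\tfrac{\langle\varphi u\rangle}{\langle\varphi\rangle},\tfrac{\langle\varphi w\rangle}{\langle\varphi\rangle}\right)\right\rangle+\langle\varphi p_{nh}\rangle\right)\right]=0.$$
   Context: Notation: $x\in\mathbb{R}$ is the horizontal coordinate, $z$ the vertical one, $t$ time, $g$ the constant gravity acceleration. The bottom is $z=z_b(x)$ (given, independent of $t$), the free surface is $z=\eta(x,t)$, and $H=\eta-z_b>0$ is the water height. The function $\varphi(x,z,t)$ is the indicator function of the fluid region $\{z_b(x)\le z\le\eta(x,t)\}$. For a function $f=f(x,z,t)$, $\langle f\rangle(x,t)=\int_{\mathbb{R}}f(x,z,t)\,dz$; in particular $\langle\varphi\rangle=H$ and $\langle\varphi z\rangle=\frac{\eta^2-z_b^2}{2}$. Free-surface Euler system for the velocity $(u,w)$ and pressure $p$: $$\frac{\partial\varphi}{\partial t}+\frac{\partial(\varphi u)}{\partial x}+\frac{\partial(\varphi w)}{\partial z}=0,$$ $$\frac{\partial(\varphi u)}{\partial t}+\frac{\partial(\varphi u^2)}{\partial x}+\frac{\partial(\varphi uw)}{\partial z}+\varphi\frac{\partial p}{\partial x}=0,$$ $$\frac{\partial(\varphi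 w)}{\partial t}+\frac{\partial(\varphi uw)}{\partial x}+\frac{\partial(\varphi w^2)}{\partial z}+\varphi\frac{\partial p}{\partial z}=-\varphi g,$$ with the boundary conditions $$\frac{\partial\eta}{\partial t}+u_s\frac{\partial\eta}{\partial x}-w_s=0,\qquad u_b\frac{\partial z_b}{\partial x}-w_b=0,\qquad p|_s=0,$$ where the subscripts $s$ and $b$ denote values at the free surface $z=\eta$ and at the bottom $z=z_b$ (the atmospheric pressure is taken to be zero). The non-hydrostatic pressure $p_{nh}$ is defined by $p=g(\eta-z)+p_{nh}$, and $p_{nh}|_b$ is its value at $z=z_b$. The energy is $E(z;u,w)=\frac{u^2+w^2}{2}+gz$.
   Formalization: The printed energy flux is false as it stands; the formal balance replaces ⟨φp_nh⟩ in the flux by the full pressure g⟨φ(η−z)⟩+⟨φp_nh⟩, and solutions are taken to be classical (C¹ up to bottom and surface). *)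

(* Defs.v *)
From Stdlib Require Export Reals.
From Coquelicot Require Export Coquelicot.
Open Scope R_scope.

Definition dx (f : R -> R -> R) (x t : R) : R := Derive (fun s => f s t) x.
Definition dt (f : R -> R -> R) (x t : R) : R := Derive (fun s => f x s) t.

Definition d3x (f : R -> R -> R -> R) (x z t : R) : R := Derive (fun s => f s z t) x.
Definition d3z (f : R -> R -> R -> R) (x z t : R) : R := Derive (fun s => f x s t) z.
Definition d3t (f : R -> R -> R -> R) (x z t : R) : R := Derive (fun s => f x z s) t.

Definition C1_1 (f : R -> R) : Prop :=
  forall x, ex_derive f x /\ continuous (Derive f) x.

(* J is used below only for open sets of times. *)
Definition C1_2 (J : R -> Prop) (f : R -> R -> R) : Prop :=
  forall x t, J t ->
    ex_derive (fun s => f s t) x /\ ex_derive (fun s => f x s) t /\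
    continuous (fun q : R * R => dx f (fst q) (snd q)) (x, t) /\
    continuous (fun q : R * R => dt f (fst q) (snd q)) (x, t).

Definition uncurry3 (f : R -> R -> R -> R) (q : R * R * R) : R :=
  f (fst (fst q)) (snd (fst q)) (snd q).

Definition C1_3_near (f : R -> R -> R -> R) (x z t : R) : Prop :=
  locally (x, z, t) (fun q : R * R * R =>
    let '(x', z', t') := q in
    ex_derive (fun s => f s z' t') x' /\
    ex_derive (fun s => f x' s t') z' /\
    ex_derive (fun s => f x' z' s) t' /\
    continuous (uncurry3 (d3x f)) q /\
    continuous (uncurry3 (d3z f)) q /\
    continuous (uncurry3 (d3t f)) q).

(* d_t F + d_x G = S at (x, t), including the existence of both derivatives
   ([Derive] alone is a total operator). *)
Definition balance (F G S : R -> R -> R) (x t : R) : Prop :=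
  ex_derive (fun s => F x s) t /\ ex_derive (fun s => G s t) x /\
  dt F x t + dx G x t = S x t.

Definition phi (zb : R -> R) (eta : R -> R -> R) (x z t : R) : R :=
  if Rle_dec (zb x) z then if Rle_dec z (eta x t) then 1 else 0 else 0.

Definition vint (f : R -> R -> R -> R) (x t : R) : R :=
  RInt_gen (fun z => f x z t) (Rbar_locally m_infty) (Rbar_locally p_infty).

(* < phi f > *)
Definition avg (zb : R -> R) (eta : R -> R -> R) (f : R -> R -> R -> R) (x t : R) : R :=
  vint (fun x z t => phi zb eta x z t * f x z t) x t.

(* < phi > *)
Definition height (zb : R -> R) (eta : R -> R -> R) (x t : R) : R :=
  vint (phi zb eta) x t.

Definition p_nh (g : R) (eta : R -> R -> R) (p : R -> R -> R -> R) (x z t : R) : R :=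
  p x z t - g * (eta x t - z).

(* The fields are defined on the whole space, but only their values near the
   closed fluid region matter: they are C^1 up to the bottom and the surface.
   Since phi jumps across z = zb and z = eta, the equations are imposed
   classically off these two interfaces; what they express on the interfaces is
   the content of the boundary conditions. *)
Record euler_solution (J : R -> Prop) (g : R) (zb : R -> R) (eta : R -> R -> R)
    (u w p : R -> R -> R -> R) : Prop := {
  eul_eta_C1 : C1_2 J eta;
  eul_height_pos : forall x t, J t -> zb x < eta x t;
  eul_fields_C1 : forall x z t, J t -> zb x <= z <= eta x t ->
    C1_3_near u x z t /\ C1_3_near w x z t /\ C1_3_near p x z t;
  eul_mass : forall x z t, J t -> z <> zb x -> z <> eta x t ->
    d3t (phi zb eta) x z t
    + d3x (fun x z t => phi zb eta x z t * u x z t) x z t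
    + d3z (fun x z t => phi zb eta x z t * w x z t) x z t = 0;
  eul_momentum_x : forall x z t, J t -> z <> zb x -> z <> eta x t ->
    d3t (fun x z t => phi zb eta x z t * u x z t) x z t
    + d3x (fun x z t => phi zb eta x z t * (u x z t) ^ 2) x z t
    + d3z (fun x z t => phi zb eta x z t * (u x z t * w x z t)) x z t
    + phi zb eta x z t * d3x p x z t = 0;
  eul_momentum_z : forall x z t, J t -> z <> zb x -> z <> eta x t ->
    d3t (fun x z t => phi zb eta x z t * w x z t) x z t
    + d3x (fun x z t => phi zb eta x z t * (u x z t * w x z t)) x z t
    + d3z (fun x z t => phi zb eta x z t * (w x z t) ^ 2) x z t
    + phi zb eta x z t * d3z p x z t = - phi zb eta x z t * g;
  eul_surface : forall x t, J t ->
    dt eta x t + u x (eta x t) t * dx eta x t - w x (eta x t) t = 0;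
  eul_bottom : forall x t, J t ->
    u x (zb x) t * Derive zb x - w x (zb x) t = 0;
  eul_surface_pressure : forall x t, J t -> p x (eta x t) t = 0
}.

Record closure_relations (J : R -> Prop) (g : R) (zb : R -> R) (eta : R -> R -> R)
    (u w p : R -> R -> R -> R) : Prop := {
  clo_uu : forall x t, J t ->
    avg zb eta (fun x z t => (u x z t) ^ 2) x t
    = (avg zb eta u x t) ^ 2 / height zb eta x t;
  clo_uw : forall x t, J t ->
    avg zb eta (fun x z t => u x z t * w x z t) x t
    = avg zb eta u x t * avg zb eta w x t / height zb eta x t;
  clo_zu : forall x t, J t ->
    avg zb eta (fun x z t => z * u x z t) x t
    = avg zb eta (fun x z t => z) x t * (avg zb eta u x t / height zb eta x t);
  clo_pnh : forall x t, J t ->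
    p_nh g eta p x (zb x) t
    = 2 * (avg zb eta (p_nh g eta p) x t / height zb eta x t)
}.

(* The depth-averaged system in the unknowns eta, hu = <phi u>, hw = <phi w>
   and hp = <phi p_nh>, which are functions of (x, t) only. *)
Record averaged_system (J : R -> Prop) (g : R) (zb : R -> R)
    (eta hu hw hp : R -> R -> R) : Prop := {
  avs_mass : forall x t, J t ->
    balance (height zb eta) hu (fun _ _ => 0) x t;
  avs_momentum_x : forall x t, J t ->
    balance hu
      (fun x t => (hu x t) ^ 2 / height zb eta x t
                  + g * avg zb eta (fun x z t => eta x t - z) x t
                  + hp x t)
      (fun x t => - (g * height zb eta x t + 2 * (hp x t / height zb eta x t))
                  * Derive zb x) x t;
  avs_momentum_z : forall x t, J t ->
    balance hw
      (fun x t => hw x t * (hu x t / height zb eta x t))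
      (fun x t => 2 * (hp x t / height zb eta x t)) x t;
  avs_z : forall x t, J t ->
    balance (avg zb eta (fun x z t => z))
      (fun x t => avg zb eta (fun x z t => z) x t * (hu x t / height zb eta x t))
      hw x t
}.

Definition energy (g z u w : R) : R := (u ^ 2 + w ^ 2) / 2 + g * z.

(* < phi E(z; <phi u>/<phi>, <phi w>/<phi>) > *)
Definition avg_energy (g : R) (zb : R -> R) (eta hu hw : R -> R -> R) (x t : R) : R :=
  avg zb eta (fun x z t => energy g z (hu x t / height zb eta x t)
                                      (hw x t / height zb eta x t)) x t.

(* The pressure work involves the full pressure
   <phi p> = g <phi (eta - z)> + <phi p_nh>: the hydrostatic part does not
   cancel against the potential energy g z, whose flux only accounts for
   g <phi z> <phi u>/<phi>. *)
Definition energy_flux (g : R) (zb : R -> R) (eta hu hw hp : R -> R -> R) (x t : R) : R :=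
  hu x t / height zb eta x t
  * (avg_energy g zb eta hu hw x t
     + (g * avg zb eta (fun x z t => eta x t - z) x t + hp x t)).

(* Main.v *)
(* Integrate each Euler equation over the fluid column.  For fields that are C^1
   up to the bottom and the surface, Leibniz' rule turns
   A_t + B_x + C_z = S into  <A>_t + <B>_x = <S> + boundary terms, and the
   kinematic conditions cancel the boundary terms except for the pressure.
   The fluxes used are (A, B, C) = (1, u, w), (u, u^2 + p, u w),
   (w, u w, w^2 + p) and (z, z u, z w); the closure relations then express
   everything through the averages.
   For the energy, let U = <u>/H and W = <w>/H.  Adding U times the horizontal
   balance, W times the vertical one and g times the balance of <z> leaves the
   residual (g H + 2 <p_nh>/H) (W - U z_b' + H U_x / 2), which vanishes because
   the balances of H and <z> together say W = U z_b' - H U_x / 2. *)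
Require Import Defs.
From Stdlib Require Import Lra ClassicalEpsilon FunctionalExtensionality.

(** * Functions of class C^1 near a point of the plane *)

Definition C1_at2 (f : R -> R -> R) (y z : R) : Prop :=
  ex_derive (fun s => f s z) y /\ ex_derive (fun s => f y s) z /\
  continuity_2d_pt (fun u v => Derive (fun s => f s v) u) y z /\
  continuity_2d_pt (fun u v => Derive (fun s => f u s) v) y z.

(** Since [Derive] is total, continuity of a partial derivative at a point carries information only
    when the derivative exists at all nearby points. Asking for [C1_at2] on a neighbourhood ensures
    this and makes the property open. *)
Definition C1_near2 (f : R -> R -> R) (y z : R) : Prop := locally_2d (C1_at2 f) y z.

Lemma locally_2d_locally_2d (P : R -> R -> Prop) (y z : R) :
  locally_2d P y z -> locally_2d (locally_2d P) y z.
Proof.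
intros H; apply locally_2d_impl_strong with (2 := H).
now apply locally_2d_forall.
Qed.

Lemma C1_near2_at (f : R -> R -> R) (y z : R) : C1_near2 f y z -> C1_at2 f y z.
Proof. exact (locally_2d_singleton _ _ _). Qed.

(** One partial derivative that exists nearby and is continuous, together with the other one at the
    point, gives Fréchet differentiability, hence joint continuity. *)
Lemma C1_near2_continuity (f : R -> R -> R) (y z : R) :
  C1_near2 f y z -> continuity_2d_pt f y z.
Proof.
intros H; apply continuity_2d_pt_filterlim.
apply (filterdiff_continuous (U := prod_NormedModule R_AbsRing R_NormedModule R_NormedModule)
  (fun u : R * R => f (fst u) (snd u)) (y, z)).
eexists.
apply (is_derive_filterdiff f y z (fun u v => Derive (fun s => f s v) u)
  (Derive (fun s => f y s) z)).
- apply locally_2d_locally in H.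
  eapply filter_imp; [|exact H]; intros [u v] Hu; apply Derive_correct; apply Hu.
- apply Derive_correct; apply C1_near2_at in H; apply H.
- apply C1_near2_at in H; destruct H as (_ & _ & H & _).
  now apply continuity_2d_pt_filterlim in H.
Qed.

(** Candidate formulas that are the partial derivatives on a whole neighbourhood coincide there with
    [Derive], which thus inherits their continuity. Sums and products are treated through such
    formulas. *)
Lemma C1_near2_of_derive (f fy fz : R -> R -> R) (y z : R) :
  locally_2d (fun u v => is_derive (fun s => f s v) u (fy u v) /\
    is_derive (fun s => f u s) v (fz u v) /\
    continuity_2d_pt fy u v /\ continuity_2d_pt fz u v) y z ->
  C1_near2 f y z.
Proof.
intros H; apply locally_2d_locally_2d in H.
apply locally_2d_impl with (2 := H); apply locally_2d_forall; intros u v Huv.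
destruct (locally_2d_singleton _ _ _ Huv) as (H1 & H2 & H3 & H4).
split; [now eexists; eauto|]; split; [now eexists; eauto|]; split.
- apply continuity_2d_pt_ext_loc with fy; trivial.
  apply locally_2d_impl with (2 := Huv); apply locally_2d_forall; intros u' v' H'.
  symmetry; apply is_derive_unique, H'.
- apply continuity_2d_pt_ext_loc with fz; trivial.
  apply locally_2d_impl with (2 := Huv); apply locally_2d_forall; intros u' v' H'.
  symmetry; apply is_derive_unique, H'.
Qed.

Lemma C1_near2_const (c y z : R) : C1_near2 (fun _ _ => c) y z.
Proof.
apply C1_near2_of_derive with (fun _ _ => 0) (fun _ _ => 0).
apply locally_2d_forall; intros u v.
split; [|split; [|split]]; try apply continuity_2d_pt_const; now auto_derive.
Qed.

Lemma C1_near2_snd (y z : R) : C1_near2 (fun _ v => v) y z.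
Proof.
apply C1_near2_of_derive with (fun _ _ => 0) (fun _ _ => 1).
apply locally_2d_forall; intros u v.
split; [|split; [|split]]; try apply continuity_2d_pt_const; now auto_derive.
Qed.

Lemma C1_near2_plus (f h : R -> R -> R) (y z : R) :
  C1_near2 f y z -> C1_near2 h y z -> C1_near2 (fun u v => f u v + h u v) y z.
Proof.
intros Hf Hh; eapply C1_near2_of_derive.
apply locally_2d_impl with (2 := locally_2d_and _ _ _ _ Hf Hh).
apply locally_2d_forall; intros u v [(F1 & F2 & F3 & F4) (H1 & H2 & H3 & H4)].
split; [|split; [|split]].
- apply (is_derive_plus (V := R_NormedModule)); apply Derive_correct; eassumption.
- apply (is_derive_plus (V := R_NormedModule)); apply Derive_correct; eassumption.
- now apply continuity_2d_pt_plus.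
- now apply continuity_2d_pt_plus.
Qed.

Lemma C1_near2_mult (f h : R -> R -> R) (y z : R) :
  C1_near2 f y z -> C1_near2 h y z -> C1_near2 (fun u v => f u v * h u v) y z.
Proof.
intros Hf Hh.
apply C1_near2_of_derive with
  (fun u v => Derive (fun s => f s v) u * h u v + f u v * Derive (fun s => h s v) u)
  (fun u v => Derive (fun s => f u s) v * h u v + f u v * Derive (fun s => h u s) v).
apply locally_2d_locally_2d in Hf; apply locally_2d_locally_2d in Hh.
apply locally_2d_impl with (2 := locally_2d_and _ _ _ _ Hf Hh).
apply locally_2d_forall; intros u v [Fl Hl].
assert (Cf := C1_near2_continuity _ _ _ Fl); assert (Ch := C1_near2_continuity _ _ _ Hl).
destruct (C1_near2_at _ _ _ Fl) as (F1 & F2 & F3 & F4).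
destruct (C1_near2_at _ _ _ Hl) as (H1 & H2 & H3 & H4).
split; [|split; [|split]].
- apply (is_derive_mult (K := R_AbsRing) (fun s => f s v) (fun s => h s v));
   try (apply Derive_correct; eassumption); exact Rmult_comm.
- apply (is_derive_mult (K := R_AbsRing) (fun s => f u s) (fun s => h u s));
   try (apply Derive_correct; eassumption); exact Rmult_comm.
- apply continuity_2d_pt_plus; now apply continuity_2d_pt_mult.
- apply continuity_2d_pt_plus; now apply continuity_2d_pt_mult.
Qed.

(* A tube lemma: the compactness of [a, b] turns neighbourhoods of the points
   of a vertical segment into a uniform one. *)
Lemma locally_2d_segment (P : R -> R -> Prop) (x a b : R) :
  a <= b ->
  (forall z, a <= z <= b -> locally_2d P x z) ->
  exists eps : posreal, forall y z,
    Rabs (y - x) < eps -> a - eps <= z <= b + eps -> P y z.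
Proof.
intros Hab HP.
(* The factor 2 keeps a reserve: one radius covers the distance from the projected point to the
   centre found by compactness, the other the distance to that projection. *)
assert (Hd : forall z, exists d : posreal, a <= z <= b ->
  forall u v, Rabs (u - x) < 2 * d -> Rabs (v - z) < 2 * d -> P u v).
{ intros z; destruct (excluded_middle_informative (a <= z <= b)) as [Hz|Hz].
  - destruct (HP z Hz) as [d Hd].
    exists (pos_div_2 d); intros _ u v Hu Hv; simpl in Hu, Hv; apply Hd; lra.
  - exists (mkposreal 1 Rlt_0_1); tauto. }
pose (delta z := proj1_sig (constructive_indefinite_description _ (Hd z))).
destruct (compactness_value_1d a b delta) as [d Hdd].
exists (pos_div_2 d); intros y z Hy Hz; simpl in Hy, Hz.
(* [z0] is the projection of [z] onto [a, b]; it moves [z] by at most the allowed overshoot d /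
   2. *)
pose (z0 := Rmax a (Rmin b z)).
assert (Hz0 : a <= z0 <= b /\ Rabs (z - z0) <= d / 2).
{ assert (Hd0 := cond_pos d); unfold z0, Rmax, Rmin.
  destruct (Rle_dec b z); destruct (Rle_dec a _); split; try lra; apply Rabs_le; lra. }
(* Compactness yields the centre [t] only under a double negation, so the goal is proved by
   contradiction. *)
apply NNPP; intros HN; apply (Hdd z0 (proj1 Hz0)); intros (t & Ht & Hzt & Hdt); apply HN.
unfold delta in Hzt, Hdt.
destruct (constructive_indefinite_description _ (Hd t)) as [e He]; simpl in Hzt, Hdt.
assert (Hd0 := cond_pos d).
apply (He Ht); [lra|].
replace (z - t) with ((z - z0) + (z0 - t)) by ring.
apply Rle_lt_trans with (1 := Rabs_triang _ _); lra.
Qed.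

(** * Leibniz rule and depth averages *)

Lemma continuity_2d_pt_snd (f : R -> R -> R) (y z : R) :
  continuity_2d_pt f y z -> continuous (f y) z.
Proof.
intros H; apply continuity_pt_filterlim; intros eps Heps.
destruct (H (mkposreal _ Heps)) as [d Hd]; exists d; split; [apply cond_pos|].
intros v [_ Hv]; apply Hd; [|exact Hv].
rewrite Rminus_diag, Rabs_R0; apply cond_pos.
Qed.

(** The tube lemma extends the regularity from the closed segment to a slightly larger rectangle,
    where the integrals for nearby parameters and displaced bounds exist. *)
Lemma is_derive_RInt_C1 (f : R -> R -> R) (a b : R -> R) (x da db : R) :
  a x <= b x -> is_derive a x da -> is_derive b x db ->
  (forall z, a x <= z <= b x -> C1_near2 f x z) ->
  is_derive (fun y => RInt (f y) (a y) (b y)) x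
    (RInt (fun z => Derive (fun s => f s z) x) (a x) (b x)
     + - f x (a x) * da + f x (b x) * db).
Proof.
intros Hab Ha Hb Hf.
destruct (locally_2d_segment _ _ _ _ Hab Hf) as [eps He].
assert (Hint : forall c d, a x - eps <= c -> c <= d -> d <= b x + eps ->
  locally x (fun y => ex_RInt (f y) c d)).
{ intros c d Hc Hcd Hd; exists eps; intros y Hy.
  apply (ex_RInt_continuous (V := R_CompleteNormedModule)); intros z Hz.
  rewrite Rmin_left, Rmax_right in Hz by easy.
  apply (ex_derive_continuous (K := R_AbsRing) (V := R_NormedModule)).
  apply (He y z); [exact Hy|lra]. }
assert (Hpos := cond_pos eps).
apply (is_derive_RInt_param_bound_comp f a b x da db); trivial.
- apply Hint; lra.
- exists eps; apply Hint; lra.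
- exists eps; apply Hint; lra.
- exists eps; exists eps; intros y Hy z Hz.
  rewrite Rmin_left, Rmax_right in Hz by lra.
  apply (He y z); [exact Hy|lra].
- intros z Hz; rewrite Rmin_left, Rmax_right in Hz by easy.
  apply C1_near2_at; auto.
- eapply locally_2d_impl; [|apply (Hf (a x)); lra].
  apply locally_2d_forall; intros u v H; apply H.
- eapply locally_2d_impl; [|apply (Hf (b x)); lra].
  apply locally_2d_forall; intros u v H; apply H.
- apply continuity_pt_filterlim, continuity_2d_pt_snd, C1_near2_continuity, Hf; lra.
- apply continuity_pt_filterlim, continuity_2d_pt_snd, C1_near2_continuity, Hf; lra.
Qed.

(** * Averages as integrals over the fluid column *)

Lemma phi_in (zb : R -> R) (eta : R -> R -> R) (x z t : R) :
  zb x <= z <= eta x t -> phi zb eta x z t = 1.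
Proof.
intros H; unfold phi; destruct (Rle_dec _ _); [destruct (Rle_dec _ _)|]; trivial; lra.
Qed.

Lemma phi_out (zb : R -> R) (eta : R -> R -> R) (x z t : R) :
  z < zb x \/ eta x t < z -> phi zb eta x z t = 0.
Proof.
intros H; unfold phi; destruct (Rle_dec _ _); [destruct (Rle_dec _ _)|]; trivial; lra.
Qed.

(** Only the open interval matters because [phi] still equals 1 on the two interfaces, which are end
    points of the dry intervals. *)
Lemma is_RInt_zero (f : R -> R) (a b : R) :
  a <= b -> (forall z, a < z < b -> f z = 0) -> is_RInt f a b 0.
Proof.
intros Hab Hf; apply is_RInt_ext with (fun _ => 0).
- intros z; rewrite Rmin_left, Rmax_right by easy; intros Hz; symmetry; auto.
- assert (H := is_RInt_const (V := R_NormedModule) a b 0).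
  now rewrite (scal_zero_r (V := R_NormedModule)) in H.
Qed.

(** As soon as the lower bound is below the bottom and the upper one above the surface, the
    truncated integral no longer depends on them, so the improper integral is the limit of an
    eventually constant quantity. *)
Lemma avg_RInt (zb : R -> R) (eta : R -> R -> R) (f : R -> R -> R -> R) (x t : R) :
  zb x <= eta x t ->
  (forall z, zb x <= z <= eta x t -> continuous (fun z => f x z t) z) ->
  avg zb eta f x t = RInt (fun z => f x z t) (zb x) (eta x t).
Proof.
intros Hle Hf; apply is_RInt_gen_unique; try apply Proper_StrongProper; try apply _.
assert (Hi : is_RInt (fun z => f x z t) (zb x) (eta x t)
  (RInt (fun z => f x z t) (zb x) (eta x t))).
{ apply (RInt_correct (V := R_CompleteNormedModule)).
  apply (ex_RInt_continuous (V := R_CompleteNormedModule)).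
  intros z Hz; rewrite Rmin_left, Rmax_right in Hz by easy; auto. }
intros P HP.
apply Filter_prod with (fun a => a < zb x) (fun b => eta x t < b).
- now exists (zb x).
- now exists (eta x t).
- intros a b Ha Hb.
  exists (RInt (fun z => f x z t) (zb x) (eta x t)); split; [simpl|now apply locally_singleton].
  (* The two zeros are the contributions of the regions below the bottom and above the surface. *)
  replace (RInt (fun z => f x z t) (zb x) (eta x t))
    with (plus 0 (plus (RInt (fun z => f x z t) (zb x) (eta x t)) 0))
    by (unfold plus; simpl; ring).
  apply (is_RInt_Chasles (V := R_NormedModule)) with (zb x);
    [|apply (is_RInt_Chasles (V := R_NormedModule)) with (eta x t)].
  + apply is_RInt_zero; [lra|].
    intros z Hz; rewrite phi_out by lra; apply Rmult_0_l.
  + apply is_RInt_ext with (2 := Hi).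
    intros z Hz; rewrite Rmin_left, Rmax_right in Hz by lra; rewrite phi_in by lra.
    symmetry; apply Rmult_1_l.
  + apply is_RInt_zero; [lra|].
    intros z Hz; rewrite phi_out by lra; apply Rmult_0_l.
Qed.

Lemma height_avg (zb : R -> R) (eta : R -> R -> R) (x t : R) :
  height zb eta x t = avg zb eta (fun _ _ _ => 1) x t.
Proof.
apply (f_equal (fun f => RInt_gen f _ _)).
apply functional_extensionality; intros z; symmetry; apply Rmult_1_r.
Qed.

(** * Balance laws integrated over the water column *)

(* Every derivation below varies only (x, z) or only (z, t), so the
   two-dimensional calculus suffices. *)
Definition C1_slices (f : R -> R -> R -> R) (x z t : R) : Prop :=
  C1_near2 (fun x z => f x z t) x z /\ C1_near2 (fun t z => f x z t) t z.

Lemma continuous_slice_xz (f : R -> R -> R -> R) (x z t : R) :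
  continuous (uncurry3 f) (x, z, t) -> continuity_2d_pt (fun x z => f x z t) x z.
Proof.
intros H; apply continuity_2d_pt_filterlim; intros P HP.
destruct (H P HP) as [d Hd]; exists d; intros [u v] [Hu Hv].
apply (Hd (u, v, t)); split; [split|]; trivial; apply ball_center.
Qed.

Lemma continuous_slice_tz (f : R -> R -> R -> R) (x z t : R) :
  continuous (uncurry3 f) (x, z, t) -> continuity_2d_pt (fun t z => f x z t) t z.
Proof.
intros H; apply continuity_2d_pt_filterlim; intros P HP.
destruct (H P HP) as [d Hd]; exists d; intros [u v] [Hu Hv].
apply (Hd (x, v, u)); split; [split|]; trivial; apply ball_center.
Qed.

(** Fixing one coordinate of a box in three variables leaves a box in two. Both slices put z second,
    since it is the integration variable in the Leibniz rule. *)
Lemma C1_3_near_slices (f : R -> R -> R -> R) (x z t : R) :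
  C1_3_near f x z t -> C1_slices f x z t.
Proof.
intros [d Hd]; split; exists d; intros u v Hu Hv.
- destruct (Hd (u, v, t)) as (D1 & D2 & _ & C1 & C2 & _).
  { split; [split|]; trivial; apply ball_center. }
  split; [|split; [|split]]; trivial.
  + exact (continuous_slice_xz (d3x f) u v t C1).
  + exact (continuous_slice_xz (d3z f) u v t C2).
- destruct (Hd (x, v, u)) as (_ & D1 & D2 & _ & C1 & C2).
  { split; [split|]; trivial; apply ball_center. }
  split; [|split; [|split]]; trivial.
  + exact (continuous_slice_tz (d3t f) x v u C2).
  + exact (continuous_slice_tz (d3z f) x v u C1).
Qed.

Lemma C1_slices_const (c x z t : R) : C1_slices (fun _ _ _ => c) x z t.
Proof. split; apply C1_near2_const. Qed.

Lemma C1_slices_z (x z t : R) : C1_slices (fun _ z _ => z) x z t.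
Proof. split; apply C1_near2_snd. Qed.

Lemma C1_slices_plus (f h : R -> R -> R -> R) (x z t : R) :
  C1_slices f x z t -> C1_slices h x z t ->
  C1_slices (fun x z t => f x z t + h x z t) x z t.
Proof. intros [F1 F2] [H1 H2]; split; now apply C1_near2_plus. Qed.

Lemma C1_slices_mult (f h : R -> R -> R -> R) (x z t : R) :
  C1_slices f x z t -> C1_slices h x z t ->
  C1_slices (fun x z t => f x z t * h x z t) x z t.
Proof. intros [F1 F2] [H1 H2]; split; now apply C1_near2_mult. Qed.

Lemma C1_slices_sqr (f : R -> R -> R -> R) (x z t : R) :
  C1_slices f x z t -> C1_slices (fun x z t => f x z t ^ 2) x z t.
Proof.
intros H; apply (C1_slices_mult f (fun x z t => f x z t * 1)); trivial.
apply (C1_slices_mult f (fun _ _ _ => 1)); trivial; apply C1_slices_const.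
Qed.

Lemma C1_slices_ex_derive (f : R -> R -> R -> R) (x z t : R) :
  C1_slices f x z t ->
  ex_derive (fun s => f s z t) x /\ ex_derive (fun s => f x s t) z /\
  ex_derive (fun s => f x z s) t.
Proof.
intros [H1 H2]; apply C1_near2_at in H1, H2; split; [apply H1|split; [apply H1|apply H2]].
Qed.

Lemma C1_slices_continuous (f : R -> R -> R -> R) (x z t : R) :
  C1_slices f x z t -> continuous (fun z => f x z t) z.
Proof.
intros H; apply (ex_derive_continuous (K := R_AbsRing) (V := R_NormedModule)).
exact (proj1 (proj2 (C1_slices_ex_derive f x z t H))).
Qed.

Lemma C1_slices_continuous_derivatives (f : R -> R -> R -> R) (x z t : R) :
  C1_slices f x z t ->
  continuous (fun z => d3x f x z t) z /\ continuous (fun z => d3z f x z t) z /\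
  continuous (fun z => d3t f x z t) z.
Proof.
intros [H1 H2]; apply C1_near2_at in H1, H2.
split; [|split]; [exact (continuity_2d_pt_snd _ _ _ (proj1 (proj2 (proj2 H1))))
 | exact (continuity_2d_pt_snd _ _ _ (proj2 (proj2 (proj2 H1))))
 | exact (continuity_2d_pt_snd _ _ _ (proj1 (proj2 (proj2 H2))))].
Qed.

(** This is the geometry common to the two halves of the theorem: it follows from an Euler solution
    as well as from the smoothness assumed for the averaged unknowns. *)
Record moving_domain (J : R -> Prop) (zb : R -> R) (eta : R -> R -> R) : Prop := {
  dom_open : open J;
  dom_bottom : forall x, ex_derive zb x;
  dom_surface_x : forall x t, J t -> ex_derive (fun s => eta s t) x;
  dom_surface_t : forall x t, J t -> ex_derive (fun s => eta x s) t;
  dom_height : forall x t, J t -> zb x < eta x t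
}.

Lemma is_derive_avg_x (J : R -> Prop) (zb : R -> R) (eta : R -> R -> R)
    (f : R -> R -> R -> R) :
  moving_domain J zb eta ->
  (forall x z t, J t -> zb x <= z <= eta x t -> C1_slices f x z t) ->
  forall x t, J t ->
  is_derive (fun s => avg zb eta f s t) x
    (RInt (fun z => d3x f x z t) (zb x) (eta x t)
     - f x (zb x) t * Derive zb x + f x (eta x t) t * dx eta x t).
Proof.
intros [HJ Hb Hx Ht Hh] Hf x t Jt.
apply is_derive_ext with (fun s => RInt (fun z => f s z t) (zb s) (eta s t)).
{ intros s; symmetry; apply avg_RInt; [now apply Rlt_le, Hh|].
  intros z Hz; apply (C1_slices_continuous f); auto. }
replace (_ - _)
  with (RInt (fun z => d3x f x z t) (zb x) (eta x t) + - f x (zb x) t * Derive zb x) by ring.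
apply (is_derive_RInt_C1 (fun x z => f x z t) zb (fun s => eta s t) x).
- now apply Rlt_le, Hh.
- now apply Derive_correct.
- now apply Derive_correct, Hx.
- intros z Hz; exact (proj1 (Hf x z t Jt Hz)).
Qed.

Lemma is_derive_avg_t (J : R -> Prop) (zb : R -> R) (eta : R -> R -> R)
    (f : R -> R -> R -> R) :
  moving_domain J zb eta ->
  (forall x z t, J t -> zb x <= z <= eta x t -> C1_slices f x z t) ->
  forall x t, J t ->
  is_derive (fun s => avg zb eta f x s) t
    (RInt (fun z => d3t f x z t) (zb x) (eta x t) + f x (eta x t) t * dt eta x t).
Proof.
intros [HJ Hb Hx Ht Hh] Hf x t Jt.
(* The integral form of the average is known only at times in [J]; openness of [J] makes it valid
   near [t]. *)
apply is_derive_ext_loc with (fun s => RInt (fun z => f x z s) (zb x) (eta x s)).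
{ apply (filter_imp J); [|exact (HJ t Jt)].
  intros s Js; symmetry; apply avg_RInt; [now apply Rlt_le, Hh|].
  intros z Hz; apply (C1_slices_continuous f); auto. }
(* The added zero is the Leibniz term of the bottom, which does not move in time. *)
replace (RInt (fun z => d3t f x z t) (zb x) (eta x t))
  with (RInt (fun z => d3t f x z t) (zb x) (eta x t) + - f x (zb x) t * 0) by ring.
apply (is_derive_RInt_C1 (fun t z => f x z t) (fun _ => zb x) (fun s => eta x s) t).
- now apply Rlt_le, Hh.
- apply (is_derive_const (V := R_NormedModule)).
- now apply Derive_correct, Ht.
- intros z Hz; exact (proj2 (Hf x z t Jt Hz)).
Qed.

(** The Leibniz rule handles [A] and [B], the fundamental theorem of calculus handles [C]; what
    remains at the two ends is the flux across the surface minus the flux across the bottom. *)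
Lemma avg_balance (J : R -> Prop) (zb : R -> R) (eta : R -> R -> R)
    (A B C S : R -> R -> R -> R) :
  moving_domain J zb eta ->
  (forall x z t, J t -> zb x <= z <= eta x t ->
    C1_slices A x z t /\ C1_slices B x z t /\ C1_slices C x z t) ->
  (forall x z t, J t -> zb x < z < eta x t ->
    d3t A x z t + d3x B x z t + d3z C x z t = S x z t) ->
  (forall x z t, J t -> zb x <= z <= eta x t -> continuous (fun z => S x z t) z) ->
  forall x t, J t ->
  balance (avg zb eta A) (avg zb eta B)
    (fun x t => avg zb eta S x t
      + (A x (eta x t) t * dt eta x t + B x (eta x t) t * dx eta x t - C x (eta x t) t)
      - (B x (zb x) t * Derive zb x - C x (zb x) t)) x t.
Proof.
intros Hdom Hf Heq HS x t Jt.
assert (RA := fun x z t Jt Hz => proj1 (Hf x z t Jt Hz)).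
assert (RB := fun x z t Jt Hz => proj1 (proj2 (Hf x z t Jt Hz))).
assert (DA := is_derive_avg_t J zb eta A Hdom RA x t Jt).
assert (DB := is_derive_avg_x J zb eta B Hdom RB x t Jt).
assert (RC := fun z Hz => proj2 (proj2 (Hf x z t Jt Hz))).
assert (Hh := Rlt_le _ _ (dom_height _ _ _ Hdom x t Jt)).
split; [now eexists; eauto|split; [now eexists; eauto|]].
assert (EA := is_derive_unique _ _ _ DA : dt (avg zb eta A) x t = _).
assert (EB := is_derive_unique _ _ _ DB : dx (avg zb eta B) x t = _).
rewrite EA, EB.
rewrite avg_RInt by auto.
assert (HC : RInt (fun z => d3z C x z t) (zb x) (eta x t) = C x (eta x t) t - C x (zb x) t).
{ apply (RInt_Derive (fun z => C x z t)); intros z; rewrite Rmin_left, Rmax_right by easy; intros Hz.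
  - exact (proj1 (proj2 (C1_slices_ex_derive C x z t (RC z Hz)))).
  - exact (proj1 (proj2 (C1_slices_continuous_derivatives C x z t (RC z Hz)))). }
assert (Hsum : RInt (fun z => S x z t) (zb x) (eta x t)
  = RInt (fun z => d3t A x z t) (zb x) (eta x t) + RInt (fun z => d3x B x z t) (zb x) (eta x t)
    + RInt (fun z => d3z C x z t) (zb x) (eta x t)).
{ assert (IA : ex_RInt (fun z => d3t A x z t) (zb x) (eta x t)).
  { apply (ex_RInt_continuous (V := R_CompleteNormedModule)); intros z.
    rewrite Rmin_left, Rmax_right by easy; intros Hz.
    exact (proj2 (proj2 (C1_slices_continuous_derivatives A x z t (RA x z t Jt Hz)))). }
  assert (IB : ex_RInt (fun z => d3x B x z t) (zb x) (eta x t)).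
  { apply (ex_RInt_continuous (V := R_CompleteNormedModule)); intros z.
    rewrite Rmin_left, Rmax_right by easy; intros Hz.
    exact (proj1 (C1_slices_continuous_derivatives B x z t (RB x z t Jt Hz))). }
  assert (IC : ex_RInt (fun z => d3z C x z t) (zb x) (eta x t)).
  { apply (ex_RInt_continuous (V := R_CompleteNormedModule)); intros z.
    rewrite Rmin_left, Rmax_right by easy; intros Hz.
    exact (proj1 (proj2 (C1_slices_continuous_derivatives C x z t (RC z Hz)))). }
  (* Equality of the integrals needs the pointwise equation only in the open column, which is where
     it is assumed. *)
  rewrite <- (RInt_ext (fun z => d3t A x z t + d3x B x z t + d3z C x z t)).
  - rewrite (RInt_plus (V := R_CompleteNormedModule) (fun z => d3t A x z t + d3x B x z t)); trivial.
    + now rewrite (RInt_plus (V := R_CompleteNormedModule)).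
    + now apply (ex_RInt_plus (V := R_NormedModule)).
  - intros z; rewrite Rmin_left, Rmax_right by easy; auto. }
rewrite Hsum, HC; ring.
Qed.

(** [F] is differentiated in time and [G] in space. Closed forms hold only at times in [J] but at
    every position, hence a local condition on [F] and a global one on [G]. *)
Lemma balance_ext (F F' G G' S S' : R -> R -> R) (x t : R) :
  locally t (fun s => F x s = F' x s) -> (forall y, G y t = G' y t) -> S x t = S' x t ->
  balance F G S x t -> balance F' G' S' x t.
Proof.
intros HF HG HS (DF & DG & E); split; [|split].
- exact (ex_derive_ext_loc _ _ _ HF DF).
- exact (ex_derive_ext _ _ _ HG DG).
- rewrite <- HS, <- E; unfold dt, dx; f_equal; symmetry.
  + now apply Derive_ext_loc.
  + now apply Derive_ext.
Qed.

(** * The indicator strictly inside the fluid *)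

Lemma locally_gt (f : R -> R) (x c : R) :
  continuous f x -> c < f x -> locally x (fun y => c < f y).
Proof. intros Hf Hc; exact (Hf _ (open_gt c (f x) Hc)). Qed.

Lemma locally_lt (f : R -> R) (x c : R) :
  continuous f x -> f x < c -> locally x (fun y => f y < c).
Proof. intros Hf Hc; exact (Hf _ (open_lt c (f x) Hc)). Qed.

(** A point strictly between bottom and surface stays between them under a small displacement in x,
    z or t, by continuity of [zb] and [eta], so [phi] is constantly 1 along each of these lines
    nearby. *)
Lemma derivatives_phi_mult (J : R -> Prop) (zb : R -> R) (eta : R -> R -> R)
    (f : R -> R -> R -> R) (x z t : R) :
  moving_domain J zb eta -> J t -> zb x < z < eta x t ->
  d3x (fun x z t => phi zb eta x z t * f x z t) x z t = d3x f x z t /\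
  d3z (fun x z t => phi zb eta x z t * f x z t) x z t = d3z f x z t /\
  d3t (fun x z t => phi zb eta x z t * f x z t) x z t = d3t f x z t.
Proof.
intros [HJ Hb Hx Ht Hh] Jt [Hz1 Hz2].
assert (Cb : continuous zb x)
  by exact (ex_derive_continuous (K := R_AbsRing) (V := R_NormedModule) _ _ (Hb x)).
assert (Cx : continuous (fun s => eta s t) x)
  by exact (ex_derive_continuous (K := R_AbsRing) (V := R_NormedModule) _ _ (Hx x t Jt)).
assert (Ct : continuous (fun s => eta x s) t)
  by exact (ex_derive_continuous (K := R_AbsRing) (V := R_NormedModule) _ _ (Ht x t Jt)).
split; [|split]; apply Derive_ext_loc.
- generalize (filter_and _ _ (locally_lt _ _ _ Cb Hz1) (locally_gt _ _ _ Cx Hz2)).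
  apply filter_imp; intros s Hs; rewrite phi_in by lra; ring.
- generalize (filter_and _ _ (open_gt _ _ Hz1) (open_lt _ _ Hz2)).
  apply filter_imp; intros s Hs; rewrite phi_in by lra; ring.
- generalize (locally_gt _ _ _ Ct Hz2).
  apply filter_imp; intros s Hs; rewrite phi_in by lra; ring.
Qed.

Lemma derivative_phi_t (J : R -> Prop) (zb : R -> R) (eta : R -> R -> R) (x z t : R) :
  moving_domain J zb eta -> J t -> zb x < z < eta x t -> d3t (phi zb eta) x z t = 0.
Proof.
intros Hdom Jt Hz.
destruct (derivatives_phi_mult J zb eta (fun _ _ _ => 1) x z t Hdom Jt Hz) as (_ & _ & H).
unfold d3t in *; rewrite (Derive_const 1) in H; rewrite <- H.
apply Derive_ext; intros s; symmetry; apply Rmult_1_r.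
Qed.

(** * Closed forms of averages, chiefly of integrands affine in z at fixed (x, t) *)

Lemma avg_affine (zb : R -> R) (eta : R -> R -> R) (f : R -> R -> R -> R) (a b x t : R) :
  zb x <= eta x t -> (forall z, f x z t = a + b * z) ->
  avg zb eta f x t = a * (eta x t - zb x) + b * ((eta x t ^ 2 - zb x ^ 2) / 2).
Proof.
intros Hle Hf.
assert (D : forall z, is_derive (fun z => a * z + b * (z ^ 2 / 2)) z (f x z t)).
{ intros z; rewrite Hf; auto_derive; trivial; field. }
assert (Cf : forall z, continuous (fun z => f x z t) z).
{ intros z; apply (ex_derive_continuous (K := R_AbsRing) (V := R_NormedModule)).
  apply ex_derive_ext with (fun z => a + b * z); [now symmetry|now auto_derive]. }
rewrite avg_RInt by auto; apply is_RInt_unique.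
evar_last; [apply (is_RInt_derive (V := R_CompleteNormedModule)); intros; [apply D|apply Cf]|].
unfold minus, plus, opp; simpl; field.
Qed.

Lemma avg_plus (zb : R -> R) (eta : R -> R -> R) (f h : R -> R -> R -> R) (x t : R) :
  zb x <= eta x t ->
  (forall z, zb x <= z <= eta x t -> continuous (fun z => f x z t) z) ->
  (forall z, zb x <= z <= eta x t -> continuous (fun z => h x z t) z) ->
  avg zb eta (fun x z t => f x z t + h x z t) x t = avg zb eta f x t + avg zb eta h x t.
Proof.
intros Hle Hf Hh; rewrite !avg_RInt; trivial.
- apply (RInt_plus (V := R_CompleteNormedModule));
  apply (ex_RInt_continuous (V := R_CompleteNormedModule)); intros z;
  rewrite Rmin_left, Rmax_right by easy; auto.
- intros z Hz; apply (continuous_plus (V := R_NormedModule)); auto.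
Qed.

Lemma height_val (zb : R -> R) (eta : R -> R -> R) (x t : R) :
  zb x <= eta x t -> height zb eta x t = eta x t - zb x.
Proof.
intros Hle; rewrite height_avg, avg_affine with (a := 1) (b := 0); trivial; [ring|intros; ring].
Qed.

Lemma avg_z (zb : R -> R) (eta : R -> R -> R) (x t : R) :
  zb x <= eta x t -> avg zb eta (fun x z t => z) x t = (eta x t ^ 2 - zb x ^ 2) / 2.
Proof.
intros Hle; rewrite avg_affine with (a := 0) (b := 1); trivial; [ring|intros; ring].
Qed.

Lemma avg_depth (zb : R -> R) (eta : R -> R -> R) (x t : R) :
  zb x <= eta x t ->
  avg zb eta (fun x z t => eta x t - z) x t = (eta x t - zb x) ^ 2 / 2.
Proof.
intros Hle; rewrite avg_affine with (a := eta x t) (b := -1); trivial; [field|intros; ring].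
Qed.

Lemma avg_energy_val (g : R) (zb : R -> R) (eta hu hw : R -> R -> R) (x t : R) :
  zb x < eta x t ->
  avg_energy g zb eta hu hw x t
  = (hu x t ^ 2 + hw x t ^ 2) / (2 * (eta x t - zb x)) + g * ((eta x t ^ 2 - zb x ^ 2) / 2).
Proof.
intros Hlt; unfold avg_energy, energy.
rewrite avg_affine with (a := ((hu x t / height zb eta x t) ^ 2
  + (hw x t / height zb eta x t) ^ 2) / 2) (b := g); [|lra|trivial].
rewrite height_val by lra; field; lra.
Qed.

(** * Energy balance of the averaged system *)

(** This is the algebra left once all derivatives are expanded. [E] and [B] are the surface and
    bottom levels, [U] and [W] the integrated momenta (not the mean velocities), [P] the integrated
    non-hydrostatic pressure; the suffixes t and x mark derivatives. The last four hypotheses are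
    the four balances. *)
Lemma averaged_energy_identity (g E B U W P et ex bx ut ux wt wx px : R) :
  E - B <> 0 ->
  et + ux = 0 ->
  ut + (2 * U * ux / (E - B) - U ^ 2 * (ex - bx) / (E - B) ^ 2
        + g * ((E - B) * (ex - bx)) + px) = - (g * (E - B) + 2 * (P / (E - B))) * bx ->
  wt + ((wx * U + W * ux) / (E - B) - W * U * (ex - bx) / (E - B) ^ 2)
    = 2 * (P / (E - B)) ->
  E * et + ((E * ex - B * bx) * (U / (E - B))
    + (E ^ 2 - B ^ 2) / 2 * (ux / (E - B) - U * (ex - bx) / (E - B) ^ 2)) = W ->
  (U * ut + W * wt) / (E - B) - (U ^ 2 + W ^ 2) * et / (2 * (E - B) ^ 2) + g * (E * et)
  + ((ux / (E - B) - U * (ex - bx) / (E - B) ^ 2)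
     * ((U ^ 2 + W ^ 2) / (2 * (E - B)) + g * ((E ^ 2 - B ^ 2) / 2)
        + (g * ((E - B) ^ 2 / 2) + P))
     + U / (E - B) * ((U * ux + W * wx) / (E - B)
        - (U ^ 2 + W ^ 2) * (ex - bx) / (2 * (E - B) ^ 2) + g * (E * ex - B * bx)
        + (g * ((E - B) * (ex - bx)) + px))) = 0.
Proof.
intros HH H1 H2 H3 H4.
replace et with (- ux) in * by lra; clear H1.
(* Solving the momentum balances for [ut] and [wt], with [W] given by the balance of z, eliminates
   these three quantities and leaves a rational identity. *)
apply Rplus_eq_compat_r with (r := - (2 * U * ux / (E - B) - U ^ 2 * (ex - bx) / (E - B) ^ 2
        + g * ((E - B) * (ex - bx)) + px)) in H2.
apply Rplus_eq_compat_r with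
  (r := - ((wx * U + W * ux) / (E - B) - W * U * (ex - bx) / (E - B) ^ 2)) in H3.
rewrite Rplus_assoc, Rplus_opp_r, Rplus_0_r in H2, H3.
subst ut wt; subst W; field; trivial.
Qed.

Lemma balance_elim (F G S : R -> R -> R) (x t : R) :
  balance F G S x t -> forall f g : R,
  is_derive (fun s => F x s) t f -> is_derive (fun y => G y t) x g -> f + g = S x t.
Proof.
intros (_ & _ & H) f g HF HG.
rewrite <- (is_derive_unique _ _ _ HF), <- (is_derive_unique _ _ _ HG); exact H.
Qed.

Lemma balance_intro (F G S : R -> R -> R) (x t f g : R) :
  is_derive (fun s => F x s) t f -> is_derive (fun y => G y t) x g -> f + g = S x t ->
  balance F G S x t.
Proof.
intros HF HG; unfold balance.
assert (EF := is_derive_unique _ _ _ HF : dt F x t = f).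
assert (EG := is_derive_unique _ _ _ HG : dx G x t = g).
rewrite EF, EG; intros H; split; [now exists f|]; split; [now exists g|exact H].
Qed.

Lemma averaged_energy_balance (J : R -> Prop) (g : R) (zb : R -> R)
    (eta hu hw hp : R -> R -> R) :
  moving_domain J zb eta -> C1_2 J hu -> C1_2 J hw -> C1_2 J hp ->
  averaged_system J g zb eta hu hw hp ->
  forall x t, J t ->
    balance (avg_energy g zb eta hu hw) (energy_flux g zb eta hu hw hp) (fun _ _ => 0) x t.
Proof.
intros Hdom Cu Cw Cp [M1 M2 M3 M4] x t Jt.
specialize (M1 x t Jt); specialize (M2 x t Jt); specialize (M3 x t Jt); specialize (M4 x t Jt).
destruct Hdom as [HJ Db Dex Det Hh].
specialize (Db x); specialize (Dex x t Jt); specialize (Det x t Jt).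
destruct (Cu x t Jt) as (Dux & Dut & _); destruct (Cw x t Jt) as (Dwx & Dwt & _).
destruct (Cp x t Jt) as (Dpx & _).
assert (Hhx : forall y, zb y < eta y t) by now intros y; apply Hh.
assert (Hht : locally t (fun s => zb x < eta x s)).
{ apply (filter_imp J); [intros s Js; now apply Hh|exact (HJ t Jt)]. }
assert (HH : zb x < eta x t) by auto.
(* Freezing one variable turns every partial derivative into an ordinary derivative of a named
   slice. *)
pose (ey := fun y => eta y t); pose (uy := fun y => hu y t);
pose (wy := fun y => hw y t); pose (py := fun y => hp y t).
pose (es := fun s => eta x s); pose (us := fun s => hu x s); pose (ws := fun s => hw x s).
pose (E := eta x t); pose (B := zb x); pose (U := hu x t); pose (W := hw x t); pose (P := hp x t).
(* The eta-expansions match the form of the derivatives produced by auto_derive. *)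
pose (et := Derive (fun s => es s) t); pose (ut := Derive (fun s => us s) t);
pose (wt := Derive (fun s => ws s) t).
pose (ex := Derive (fun s => ey s) x); pose (ux := Derive (fun s => uy s) x);
pose (wx := Derive (fun s => wy s) x).
pose (px := Derive (fun s => py s) x); pose (bx := Derive (fun s => zb s) x).
(* [I1] to [I4] are the four balances with averages in closed form and derivatives expanded, in the
   shape required by [averaged_energy_identity]. *)
assert (I1 : et + ux = 0).
{ eapply balance_ext with (F' := fun x t => eta x t - zb x) (G' := hu) (S' := fun _ _ => 0) in M1;
    trivial.
  - apply (balance_elim _ _ _ _ _ M1); [|exact (Derive_correct _ _ Dux)].
    change (is_derive (fun s => es s - B) t et).
    auto_derive; [repeat split; trivial|unfold et; ring].
  - eapply filter_imp; [|exact Hht]; intros s Hs; apply height_val; simpl in Hs; lra. }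
assert (I2 : ut + (2 * U * ux / (E - B) - U ^ 2 * (ex - bx) / (E - B) ^ 2
        + g * ((E - B) * (ex - bx)) + px) = - (g * (E - B) + 2 * (P / (E - B))) * bx).
{ eapply balance_ext with (F' := hu)
    (G' := fun x t => hu x t ^ 2 / (eta x t - zb x) + g * ((eta x t - zb x) ^ 2 / 2) + hp x t)
    (S' := fun x t => - (g * (eta x t - zb x) + 2 * (hp x t / (eta x t - zb x))) * Derive zb x) in M2.
  - apply (balance_elim _ _ _ _ _ M2); [exact (Derive_correct _ _ Dut)|].
    change (is_derive (fun y => uy y ^ 2 / (ey y - zb y) + g * ((ey y - zb y) ^ 2 / 2) + py y) x
     (2 * U * ux / (E - B) - U ^ 2 * (ex - bx) / (E - B) ^ 2
        + g * ((E - B) * (ex - bx)) + px)).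
    auto_derive; [repeat split; trivial; unfold ey; lra|].
    change (uy x) with U; change (ey x) with E; change (zb x) with B.
    unfold ex, ux, bx, px; field; unfold E, B; lra.
  - now apply filter_forall.
  - intros y; cbv beta; rewrite height_val, avg_depth by (specialize (Hhx y); lra); reflexivity.
  - cbv beta; rewrite height_val by lra; reflexivity. }
assert (I3 : wt + ((wx * U + W * ux) / (E - B) - W * U * (ex - bx) / (E - B) ^ 2)
    = 2 * (P / (E - B))).
{ eapply balance_ext with (F' := hw) (G' := fun x t => hw x t * (hu x t / (eta x t - zb x)))
    (S' := fun x t => 2 * (hp x t / (eta x t - zb x))) in M3.
  - apply (balance_elim _ _ _ _ _ M3); [exact (Derive_correct _ _ Dwt)|].
    change (is_derive (fun y => wy y * (uy y / (ey y - zb y))) x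
     ((wx * U + W * ux) / (E - B) - W * U * (ex - bx) / (E - B) ^ 2)).
    auto_derive; [repeat split; trivial; unfold ey; lra|].
    change (uy x) with U; change (wy x) with W; change (ey x) with E; change (zb x) with B.
    unfold ex, ux, bx, wx; field; unfold E, B; lra.
  - now apply filter_forall.
  - intros y; cbv beta; rewrite height_val by (specialize (Hhx y); lra); reflexivity.
  - cbv beta; rewrite height_val by lra; reflexivity. }
assert (I4 : E * et + ((E * ex - B * bx) * (U / (E - B))
    + (E ^ 2 - B ^ 2) / 2 * (ux / (E - B) - U * (ex - bx) / (E - B) ^ 2)) = W).
{ eapply balance_ext with (F' := fun x t => (eta x t ^ 2 - zb x ^ 2) / 2)
    (G' := fun x t => (eta x t ^ 2 - zb x ^ 2) / 2 * (hu x t / (eta x t - zb x)))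
    (S' := hw) in M4; trivial.
  - apply (balance_elim _ _ _ _ _ M4).
    + change (is_derive (fun s => (es s ^ 2 - B ^ 2) / 2) t (E * et)).
      auto_derive; [repeat split; trivial|unfold et, E, es; field].
    + change (is_derive (fun y => (ey y ^ 2 - zb y ^ 2) / 2 * (uy y / (ey y - zb y))) x
       ((E * ex - B * bx) * (U / (E - B))
        + (E ^ 2 - B ^ 2) / 2 * (ux / (E - B) - U * (ex - bx) / (E - B) ^ 2))).
      auto_derive; [repeat split; trivial; unfold ey; lra|].
      change (uy x) with U; change (ey x) with E; change (zb x) with B.
      unfold ex, ux, bx; field; unfold E, B; lra.
  - eapply filter_imp; [|exact Hht]; intros s Hs; apply avg_z; simpl in Hs; lra.
  - intros y; cbv beta; rewrite height_val, avg_z by (specialize (Hhx y); lra); reflexivity. }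
apply balance_ext with
  (F := fun x t => (hu x t ^ 2 + hw x t ^ 2) / (2 * (eta x t - zb x))
                   + g * ((eta x t ^ 2 - zb x ^ 2) / 2))
  (G := fun x t => hu x t / (eta x t - zb x)
    * ((hu x t ^ 2 + hw x t ^ 2) / (2 * (eta x t - zb x)) + g * ((eta x t ^ 2 - zb x ^ 2) / 2)
       + (g * ((eta x t - zb x) ^ 2 / 2) + hp x t)))
  (S := fun _ _ => 0); trivial.
- eapply filter_imp; [|exact Hht]; intros s Hs; symmetry; now apply avg_energy_val.
- intros y; unfold energy_flux; rewrite avg_energy_val, height_val, avg_depth; trivial;
    apply Rlt_le; auto.
- assert (HEB : E - B <> 0) by (unfold E, B; lra).
  eapply balance_intro; [| |apply (averaged_energy_identity g E B U W P et ex bx ut ux wt wx px);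
    assumption].
  + change (is_derive (fun s => (us s ^ 2 + ws s ^ 2) / (2 * (es s - B))
      + g * ((es s ^ 2 - B ^ 2) / 2)) t
     ((U * ut + W * wt) / (E - B) - (U ^ 2 + W ^ 2) * et / (2 * (E - B) ^ 2) + g * (E * et))).
    auto_derive; [repeat split; trivial; unfold es, B; lra|].
    change (us t) with U; change (ws t) with W; change (es t) with E.
    unfold et, ut, wt; field; trivial.
  + match goal with |- is_derive _ _ ?d => change (is_derive (fun y => uy y / (ey y - zb y)
      * ((uy y ^ 2 + wy y ^ 2) / (2 * (ey y - zb y)) + g * ((ey y ^ 2 - zb y ^ 2) / 2)
       + (g * ((ey y - zb y) ^ 2 / 2) + py y))) x d) end.
    auto_derive; [repeat split; trivial; unfold ey; lra|].
    change (uy x) with U; change (wy x) with W; change (ey x) with E; change (zb x) with B;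
    change (py x) with P.
    unfold ex, ux, bx, wx, px; field; trivial.
Qed.

(** * From the Euler system to the averaged system *)

Lemma euler_moving_domain (J : R -> Prop) (g : R) (zb : R -> R) (eta : R -> R -> R)
    (u w p : R -> R -> R -> R) :
  open J -> C1_1 zb -> euler_solution J g zb eta u w p -> moving_domain J zb eta.
Proof.
intros HJ Hzb H; split; trivial.
- intros x; apply Hzb.
- intros x t Jt; apply (eul_eta_C1 _ _ _ _ _ _ _ H x t Jt).
- intros x t Jt; apply (eul_eta_C1 _ _ _ _ _ _ _ H x t Jt).
- apply (eul_height_pos _ _ _ _ _ _ _ H).
Qed.

(** The integrated horizontal flux carries the full pressure, whereas the averaged system separates
    its hydrostatic and non-hydrostatic parts. *)
Lemma avg_pressure (g : R) (zb : R -> R) (eta : R -> R -> R) (p : R -> R -> R -> R) (x t : R) :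
  zb x <= eta x t ->
  (forall z, zb x <= z <= eta x t -> continuous (fun z => p x z t) z) ->
  avg zb eta p x t
  = g * avg zb eta (fun x z t => eta x t - z) x t + avg zb eta (p_nh g eta p) x t.
Proof.
intros Hle Hp.
assert (Hhyd : forall c z, continuous (fun z => c * (eta x t - z)) z).
{ intros c z; apply (ex_derive_continuous (K := R_AbsRing) (V := R_NormedModule)).
  now auto_derive. }
transitivity (avg zb eta (fun x z t => g * (eta x t - z) + p_nh g eta p x z t) x t).
{ apply (f_equal (fun f => avg zb eta f x t)).
  do 3 (apply functional_extensionality; intros ?); unfold p_nh; ring. }
rewrite avg_plus; trivial.
- f_equal; rewrite avg_depth by easy.
  rewrite avg_affine with (a := g * eta x t) (b := - g); [field|easy|intros; ring].
- intros z Hz; unfold p_nh; apply (continuous_minus (V := R_NormedModule)); auto.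
Qed.

Lemma euler_averaged_system (J : R -> Prop) (g : R) (zb : R -> R) (eta : R -> R -> R)
    (u w p : R -> R -> R -> R) :
  open J -> C1_1 zb -> euler_solution J g zb eta u w p ->
  closure_relations J g zb eta u w p ->
  averaged_system J g zb eta
    (avg zb eta u) (avg zb eta w) (avg zb eta (p_nh g eta p)).
Proof.
intros HJ Hzb Heul [Kuu Kuw Kzu Kp].
assert (Hdom := euler_moving_domain _ _ _ _ _ _ _ HJ Hzb Heul).
destruct Heul as [_ Hh Hreg Emass Emx Emz Es Eb Ep].
assert (Hle : forall x t, J t -> zb x <= eta x t) by now intros; apply Rlt_le, Hh.
assert (Su : forall x z t, J t -> zb x <= z <= eta x t -> C1_slices u x z t).
{ intros x z t Jt Hz; apply C1_3_near_slices; exact (proj1 (Hreg x z t Jt Hz)). }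
assert (Sw : forall x z t, J t -> zb x <= z <= eta x t -> C1_slices w x z t).
{ intros x z t Jt Hz; apply C1_3_near_slices; exact (proj1 (proj2 (Hreg x z t Jt Hz))). }
assert (Sp : forall x z t, J t -> zb x <= z <= eta x t -> C1_slices p x z t).
{ intros x z t Jt Hz; apply C1_3_near_slices; exact (proj2 (proj2 (Hreg x z t Jt Hz))). }
clear Hreg.
assert (Hphi := fun f x z t => derivatives_phi_mult J zb eta f x z t Hdom).
split; intros x t Jt.
(* Inside the fluid the mass equation is incompressibility; both boundary terms vanish by the
   kinematic conditions. *)
- refine (balance_ext _ _ _ _ _ _ x t _ _ _ (avg_balance J zb eta (fun _ _ _ => 1) u w
    (fun _ _ _ => 0) Hdom _ _ _ x t Jt)).
  + apply filter_forall; intros s; symmetry; apply height_avg.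
  + reflexivity.
  + rewrite avg_affine with (a := 0) (b := 0); auto; [|intros; ring].
    assert (H1 := Es x t Jt); assert (H2 := Eb x t Jt); lra.
  + intros y z s Js Hz; split; [|split]; auto; apply C1_slices_const.
  + intros y z s Js Hz.
    destruct (Hphi u y z s Js Hz) as (Xu & _).
    destruct (Hphi w y z s Js Hz) as (_ & Zw & _).
    assert (E := Emass y z s Js ltac:(lra) ltac:(lra)).
    rewrite (derivative_phi_t J), Xu, Zw in E by trivial.
    unfold d3t; rewrite Derive_const; exact E.
  + intros; apply continuous_const.
- refine (balance_ext _ _ _ _ _ _ x t _ _ _ (avg_balance J zb eta u
    (fun x z t => u x z t ^ 2 + p x z t) (fun x z t => u x z t * w x z t)
    (fun _ _ _ => 0) Hdom _ _ _ x t Jt)).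
  + now apply filter_forall.
  + intros y; cbv beta.
    assert (Cp : forall z, zb y <= z <= eta y t -> continuous (fun z => p y z t) z)
      by (intros z Hz; apply (C1_slices_continuous p); auto).
    rewrite avg_plus; auto.
    2: intros z Hz; apply (C1_slices_continuous (fun x z t => u x z t ^ 2)), C1_slices_sqr; auto.
    rewrite Kuu by trivial; rewrite (avg_pressure g zb eta p y t (Hle y t Jt) Cp).
    symmetry; apply Rplus_assoc.
  + rewrite avg_affine with (a := 0) (b := 0); auto; [|intros; ring].
    (* The closure is read backwards: the source term becomes the bottom pressure times the slope,
       while the surface pressure is zero. *)
    rewrite <- Kp, height_val, Ep by auto; unfold p_nh.
    assert (H1 := Es x t Jt); assert (H2 := Eb x t Jt).
    set (us := u x (eta x t) t) in *; set (ub := u x (zb x) t) in *.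
    replace (w x (eta x t) t) with (dt eta x t + us * dx eta x t) by lra.
    replace (w x (zb x) t) with (ub * Derive zb x) by lra; ring.
  + intros y z s Js Hz; split; [|split]; auto.
    * apply (C1_slices_plus (fun x z t => u x z t ^ 2)); auto; apply C1_slices_sqr; auto.
    * apply (C1_slices_mult u w); auto.
  + intros y z s Js Hz; assert (Hz' : zb y <= z <= eta y s) by lra.
    destruct (Hphi u y z s Js Hz) as (_ & _ & Tu).
    destruct (Hphi (fun x z t => u x z t ^ 2) y z s Js Hz) as (Xu & _).
    destruct (Hphi (fun x z t => u x z t * w x z t) y z s Js Hz) as (_ & Zu & _).
    assert (E := Emx y z s Js ltac:(lra) ltac:(lra)).
    rewrite Tu, Xu, Zu, phi_in in E by trivial.
    replace (d3x (fun x z t => u x z t ^ 2 + p x z t) y z s)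
     with (d3x (fun x z t => u x z t ^ 2) y z s + d3x p y z s); [lra|].
    symmetry; apply Derive_plus.
    * exact (proj1 (C1_slices_ex_derive _ _ _ _ (C1_slices_sqr u y z s (Su y z s Js Hz')))).
    * exact (proj1 (C1_slices_ex_derive _ _ _ _ (Sp y z s Js Hz'))).
  + intros; apply continuous_const.
- refine (balance_ext _ _ _ _ _ _ x t _ _ _ (avg_balance J zb eta w
    (fun x z t => u x z t * w x z t) (fun x z t => w x z t ^ 2 + p x z t)
    (fun _ _ _ => - g) Hdom _ _ _ x t Jt)).
  + now apply filter_forall.
  + intros y; rewrite Kuw by trivial; unfold Rdiv; ring.
  (* The weight of the column, - g H, cancels the hydrostatic part of the bottom pressure; its
     non-hydrostatic part remains and the closure evaluates it. *)
  + rewrite avg_affine with (a := - g) (b := 0); auto; [|intros; ring].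
    rewrite <- Kp, Ep by auto; unfold p_nh.
    assert (H1 := Es x t Jt); assert (H2 := Eb x t Jt).
    set (us := u x (eta x t) t) in *; set (ub := u x (zb x) t) in *.
    replace (w x (eta x t) t) with (dt eta x t + us * dx eta x t) by lra.
    replace (w x (zb x) t) with (ub * Derive zb x) by lra; ring.
  + intros y z s Js Hz; split; [|split]; auto.
    * apply (C1_slices_mult u w); auto.
    * apply (C1_slices_plus (fun x z t => w x z t ^ 2)); auto; apply C1_slices_sqr; auto.
  + intros y z s Js Hz; assert (Hz' : zb y <= z <= eta y s) by lra.
    destruct (Hphi w y z s Js Hz) as (_ & _ & Tw).
    destruct (Hphi (fun x z t => u x z t * w x z t) y z s Js Hz) as (Xw & _).
    destruct (Hphi (fun x z t => w x z t ^ 2) y z s Js Hz) as (_ & Zw & _).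
    assert (E := Emz y z s Js ltac:(lra) ltac:(lra)).
    rewrite Tw, Xw, Zw, phi_in in E by trivial.
    replace (d3z (fun x z t => w x z t ^ 2 + p x z t) y z s)
     with (d3z (fun x z t => w x z t ^ 2) y z s + d3z p y z s); [lra|].
    symmetry; apply Derive_plus.
    * exact (proj1 (proj2 (C1_slices_ex_derive _ _ _ _ (C1_slices_sqr w y z s (Sw y z s Js Hz'))))).
    * exact (proj1 (proj2 (C1_slices_ex_derive _ _ _ _ (Sp y z s Js Hz')))).
  + intros; apply continuous_const.
(* Multiplying incompressibility by z gives (z u)_x + (z w)_z = w, which explains the source [w].
   The boundary terms are z times kinematic conditions. *)
- refine (balance_ext _ _ _ _ _ _ x t _ _ _ (avg_balance J zb eta (fun _ z _ => z)
    (fun x z t => z * u x z t) (fun x z t => z * w x z t) w Hdom _ _ _ x t Jt)).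
  + now apply filter_forall.
  + intros y; now apply Kzu.
  + assert (H1 := Es x t Jt); assert (H2 := Eb x t Jt).
    set (us := u x (eta x t) t) in *; set (ub := u x (zb x) t) in *.
    replace (w x (eta x t) t) with (dt eta x t + us * dx eta x t) by lra.
    replace (w x (zb x) t) with (ub * Derive zb x) by lra; ring.
  + intros y z s Js Hz; split; [|split].
    * apply C1_slices_z.
    * apply (C1_slices_mult (fun _ z _ => z) u); auto; apply C1_slices_z.
    * apply (C1_slices_mult (fun _ z _ => z) w); auto; apply C1_slices_z.
  + intros y z s Js Hz; assert (Hz' : zb y <= z <= eta y s) by lra.
    destruct (Hphi u y z s Js Hz) as (Xu & _).
    destruct (Hphi w y z s Js Hz) as (_ & Zw & _).
    assert (E := Emass y z s Js ltac:(lra) ltac:(lra)).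
    rewrite (derivative_phi_t J), Xu, Zw in E by trivial.
    assert (T : d3t (fun _ z _ => z) y z s = 0) by exact (Derive_const z s).
    assert (X : d3x (fun x z t => z * u x z t) y z s = z * d3x u y z s)
      by exact (Derive_scal (fun x => u x z s) z y).
    assert (Z : d3z (fun x z t => z * w x z t) y z s = w y z s + z * d3z w y z s).
    { unfold d3z; rewrite (Derive_mult (fun z => z) (fun z => w y z s)).
      - now rewrite Derive_id, Rmult_1_l.
      - apply ex_derive_id.
      - exact (proj1 (proj2 (C1_slices_ex_derive _ _ _ _ (Sw y z s Js Hz')))). }
    rewrite T, X, Z.
    replace (d3z w y z s) with (- d3x u y z s) by lra; ring.
  + intros y z s Js Hz; apply (C1_slices_continuous w); auto.
Qed.

Theorem proposition1 (J : R -> Prop) (hJ : open J) (g : R)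
    (zb : R -> R) (hzb : C1_1 zb) :
  (forall (eta : R -> R -> R) (u w p : R -> R -> R -> R),
      euler_solution J g zb eta u w p ->
      closure_relations J g zb eta u w p ->
      averaged_system J g zb eta
        (avg zb eta u) (avg zb eta w) (avg zb eta (p_nh g eta p)))
  /\
  (forall eta hu hw hp : R -> R -> R,
      C1_2 J eta -> C1_2 J hu -> C1_2 J hw -> C1_2 J hp ->
      (forall x t, J t -> zb x < eta x t) ->
      averaged_system J g zb eta hu hw hp ->
      forall x t, J t ->
        balance (avg_energy g zb eta hu hw)
                (energy_flux g zb eta hu hw hp)
                (fun _ _ => 0) x t).
Proof.
split.
- intros eta u w p; now apply euler_averaged_system.
- intros eta hu hw hp Ceta Cu Cw Cp Hh.
  apply averaged_energy_balance; trivial.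
  split; trivial; [apply hzb|apply Ceta|apply Ceta].
Qed.
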